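(* Let $t,s,\tau\in[0,1]$ and $\zeta\notin\mathrm{Spec}(H_t)\cup\mathrm{Spec}(H_s)$. Then, with $R_t(\zeta)=(H_t-\zeta)^{-1}$ and $H_t=\mathcal A_t+V_t$, $$R_t(\zeta)-R_s(\zeta)=R_t(\zeta)(V_s-V_t)R_s(\zeta)+(\mathrm T_\tau R_t(\overline\zeta))^*J\,\mathrm T_\tau R_s(\zeta),$$ and $$R_t(\zeta)-R_s(\zeta)=R_t(\zeta)(V_s-V_t)R_s(\zeta)+(\mathrm T_tR_t(\overline\zeta))^*(Q_t-Q_s)J\,\mathrm T_sR_s(\zeta)+(\mathrm T_tR_t(\overline\zeta))^*J(\mathrm T_t-\mathrm T_s)R_s(\zeta).$$ Here the operators whose adjoints appear are considered as elements of $\mathcal B(\mathcal H,\mathfrak H\times\mathfrak H)$, so that their adjoints are elements of $\mathcal B(\mathfrak H\times\mathfrak H,\mathcal H)$.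
   Context: Inner products are linear in the first argument. $\mathcal H,\mathfrak H$ are complex separable Hilbert spaces; $A$ is a densely defined, closed, symmetric operator in $\mathcal H$ with equal (possibly infinite) deficiency indices; $\mathcal H_+:=\mathrm{dom}(A^* )$ carries the graph inner product $\langle u,v\rangle_{\mathcal H}+\langle A^*u,A^*v\rangle_{\mathcal H}$. $\mathcal D$ is a dense subspace of $\mathcal H_+$ with $\mathrm{dom}(A)\subset\mathcal D$, equipped with a Banach norm $\|\cdot\|_{\mathcal D}$ for which the embedding $\mathcal D\hookrightarrow\mathcal H_+$ is bounded. For each $t\in[0,1]$, the trace operator $\mathrm T_t=[\Gamma_{0t},\Gamma_{1t}]^\top\in\mathcal B(\mathcal D,\mathfrak H\times\mathfrak H)$ has dense range and satisfies $\langle A^*u,v\rangle_{\mathcal H}-\langle u,A^*v\rangle_{\mathcal H}=\langle\Gamma_{1t}u,\Gamma_{0t}v\rangle_{\mathfrak H}-\langle\Gamma_{0t}u,\Gamma_{1t}v\rangle_{\mathfrak H}$ for $u,v\in\mathcal D$. $J=\begin{bmatrix}0&I_{\mathfrak H}\\-I_{\mathfrak H}&0\end{bmatrix}$, $\omega(f,g)=\langle Jf,g\rangle_{\mathfrak H\times\mathfrak H}$; a subspace $\mathcal F\subset\mathfrak H\times\mathfrak H$ is Lagrangian if it equals $\{f:\omega(f,g)=0\ \forall g\in\mathcal F\}$. For each $t\in[0,1]$: $Q_t$ is an orthogonal projection in $\mathfrak H\times\mathfrak H$ whose range is Lagrangian; $\mathcal A_t$ is a self-adjoint extension of $A$ with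 $\mathrm{dom}(\mathcal A_t)\subset\mathcal D$ and $\overline{\mathrm T_t(\mathrm{dom}(\mathcal A_t))}=\mathrm{ran}(Q_t)$; $V_t\in\mathcal B(\mathcal H)$ is self-adjoint; $H_t:=\mathcal A_t+V_t$. *)

(* Defs.v *)
From HB Require Import structures.
From mathcomp Require Import all_boot all_order all_algebra.
From mathcomp Require Import sesquilinear complex.
From mathcomp Require Import mathcomp_extra boolp classical_sets functions cardinality.
From mathcomp Require Import reals interval_inference topology normedtype.

Set Implicit Arguments.
Unset Strict Implicit.
Unset Printing Implicit Defensive.

Import Order.TTheory GRing.Theory Num.Theory.
Import numFieldNormedType.Exports.

Local Open Scope classical_set_scope.
Local Open Scope ring_scope.
Local Open Scope complex_scope.

(* [{dot H for conjC}] is linear in the first and conjugate-linear in the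
   second argument, and positive definite. *)
HB.mixin Record CompleteNormedModule_isHilbert (R : realType) H
    of CompleteNormedModule R[i] H := {
  hip : {dot H for (Num.conj : R[i] -> R[i])} ;
  hip_norm : forall x : H, `|x| ^+ 2 = hip x x
}.

#[short(type="hilbertType")]
HB.structure Definition Hilbert (R : realType) :=
  {H of CompleteNormedModule_isHilbert R H & CompleteNormedModule R[i] H}.

Definition ip (R : realType) (H : hilbertType R) (x y : H) : R[i] := hip x y.

(* Inner product of the Hilbert sum F (+) F. As a normed module the type F * F
   carries the library's max norm, which is equivalent to the norm of [ip2]:
   bounded operators, closures and dense sets are the same for both. *)
Definition ip2 (R : realType) (F : hilbertType R) (f g : F * F) : R[i] :=
  ip f.1 g.1 + ip f.2 g.2.

Definition separable (X : topologicalType) : Prop :=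
  exists S : set X, countable S /\ dense S.

Definition bounded_operator (R : realType) (X Y : normedModType R[i])
    (f : X -> Y) : Prop :=
  linear f /\ exists M : R[i], forall x, `|f x| <= M * `|x|.

(* Adjoint of an everywhere defined operator, for given inner products; it is
   meaningful when [f] is bounded, by the Riesz representation theorem. *)
Definition adjoint (R : realType) (X Y : normedModType R[i])
    (ipX : X -> X -> R[i]) (ipY : Y -> Y -> R[i]) (f : X -> Y) (y : Y) : X :=
  get [set x | forall u, ipY (f u) y = ipX u x].

Section UnboundedOperators.
Variables (R : realType) (H : hilbertType R).

(* A partially defined map of H; the values outside [dom] are irrelevant. *)
Record partial_map := PartialMap { dom : set H ; fn :> H -> H }.

Implicit Types (A B : partial_map) (u v w : H) (z : R[i]).

Definition linear_operator A : Prop :=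
  dom A 0 /\
  forall (a : R[i]) u v, dom A u -> dom A v ->
    dom A (a *: u + v) /\ A (a *: u + v) = a *: A u + A v.

Definition densely_defined A : Prop := dense (dom A).

Definition closed_operator A : Prop :=
  closed [set p : H * H | dom A p.1 /\ p.2 = A p.1].

Definition symmetric_operator A : Prop :=
  forall u v, dom A u -> dom A v -> ip (A u) v = ip u (A v).

(* The adjoint A^*, single-valued when A is densely defined. *)
Definition adj A : partial_map :=
  let rep v := [set w | forall u, dom A u -> ip (A u) v = ip u w] in
  PartialMap [set v | rep v !=set0] (fun v => get (rep v)).

Definition extension A B : Prop :=
  dom A `<=` dom B /\ forall u, dom A u -> B u = A u.

Definition self_adjoint A : Prop :=
  [/\ linear_operator A, densely_defined A, dom (adj A) = dom A &
      forall u, dom A u -> adj A u = A u].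

Definition perturb A (V : H -> H) : partial_map :=
  PartialMap (dom A) (fun u => A u + V u).

Definition graph_norm B u : R[i] := sqrtC (ip u u + ip (B u) (B u)).

Definition eigenvectors A z : set H := [set u | dom A u /\ A u = z *: u].

(* Maximal orthonormal system in N; its cardinality is the (possibly infinite)
   Hilbert dimension of a closed subspace N. *)
Definition orthonormal_basis (N E : set H) : Prop :=
  [/\ E `<=` N,
      forall e, E e -> ip e e = 1,
      forall e e', E e -> E e' -> e <> e' -> ip e e' = 0 &
      forall x, N x -> (forall e, E e -> ip x e = 0) -> x = 0].

Definition same_dimension (N1 N2 : set H) : Prop :=
  exists E1 E2 : set H,
    [/\ orthonormal_basis N1 E1, orthonormal_basis N2 E2 & (E1 #= E2)%card].

Definition equal_deficiency_indices A : Prop :=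
  same_dimension (eigenvectors (adj A) 'i%C) (eigenvectors (adj A) (- 'i%C)).

(* (A - z)^-1 *)
Definition resolvent A z (x : H) : H :=
  get [set u | dom A u /\ A u - z *: u = x].

Definition resolvent_set A : set R[i] :=
  [set z | (forall x, exists! u, dom A u /\ A u - z *: u = x) /\
           bounded_operator (resolvent A z)].

Definition Spec A : set R[i] := ~` resolvent_set A.

End UnboundedOperators.

Section Symplectic.
Variables (R : realType) (F : hilbertType R).

Definition J (f : F * F) : F * F := (f.2, - f.1).

Definition omega (f g : F * F) : R[i] := ip2 (J f) g.

Definition lagrangian (L : set (F * F)) : Prop :=
  L = [set f | forall g, L g -> omega f g = 0].

Definition orthogonal_projection (Q : F * F -> F * F) : Prop :=
  [/\ bounded_operator Q, forall f, Q (Q f) = Q f &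
      forall f g, ip2 (Q f) g = ip2 f (Q g)].

End Symplectic.

(* Main.v *)
(* With w = R_t(conj zeta) u and v in D, the abstract Green identity and
   A^* = cA_t on dom(cA_t) give
     <T_r w, J T_r v> = <u, R_t(zeta) (A^* v + V_t v - zeta v) - v>.
   The right-hand side is bounded in u for each v, so T_r R_t(conj zeta) has a
   densely defined adjoint and is bounded by the uniform boundedness principle.
   Taking v = R_s(zeta) x yields the first resolvent formula.  The second follows
   for r = t: T_t w lies in ran(Q_t), so Q_t may be inserted in front of
   J T_s v, while Q_s J T_s v = 0 because T_s v lies in the Lagrangian
   subspace ran(Q_s). *)
Require Import Defs.
From HB Require Import structures.
From mathcomp Require Import all_boot all_order all_algebra.
From mathcomp Require Import sesquilinear complex.
From mathcomp Require Import mathcomp_extra boolp classical_sets functions cardinality.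
From mathcomp Require Import reals interval_inference topology normedtype.
From mathcomp Require Import prodnormedzmodule ring lra.

Set Implicit Arguments.
Unset Strict Implicit.
Unset Printing Implicit Defensive.

Import Order.TTheory GRing.Theory Num.Theory.
Import numFieldNormedType.Exports ProdNormedZmodule.Exports.

Local Open Scope classical_set_scope.
Local Open Scope ring_scope.
Local Open Scope complex_scope.

(** * Inner product and Cauchy-Schwarz *)

Section InnerProduct.
Variables (R : realType) (H : hilbertType R).
Implicit Types (x y z : H) (a : R[i]).

Lemma ipDl x y z : ip (x + y) z = ip x z + ip y z.
Proof. exact: linearDl. Qed.

Lemma ipDr x y z : ip x (y + z) = ip x y + ip x z.
Proof. exact: linearDr. Qed.

Lemma ipNr x y : ip x (- y) = - ip x y.
Proof. exact: linearNr. Qed.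

Lemma ipBl x y z : ip (x - y) z = ip x z - ip y z.
Proof. exact: linearBl. Qed.

Lemma ipBr x y z : ip x (y - z) = ip x y - ip x z.
Proof. exact: linearBr. Qed.

Lemma ip0r x : ip x 0 = 0.
Proof. exact: linear0r. Qed.

Lemma ipZl a x y : ip (a *: x) y = a * ip x y.
Proof. exact: linearZl_LR. Qed.

Lemma ipZr a x y : ip x (a *: y) = conjc a * ip x y.
Proof. exact: linearZr_LR. Qed.

Lemma ipC x y : ip x y = conjc (ip y x).
Proof. by rewrite /ip hermC expr0 mul1r. Qed.

Lemma ip_norm x : ip x x = `|x| ^+ 2.
Proof. by rewrite hip_norm. Qed.

Lemma ip_eq0 x : ip x x = 0 -> x = 0.
Proof. by move/eqP; rewrite ip_norm expf_eq0 /= normr_eq0 => /eqP. Qed.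

Lemma ip_inj x y : (forall u, ip u x = ip u y) -> x = y.
Proof.
by move=> xy; apply/subr0_eq/ip_eq0; rewrite ipBr xy subrr.
Qed.

Lemma cauchy_schwarz x y : `|ip x y| <= `|x| * `|y|.
Proof.
have [->|y0] := eqVneq y 0; first by rewrite ip0r !normr0 mulr0.
set a := ip x y.
have [b [bE bJ b0]] : exists b : R[i], [/\ ip y y = b, conjc b = b & 0 < b].
  exists (ip y y); split=> //; first by rewrite -ipC.
  by rewrite ip_norm exprn_gt0 // normr_gt0.
(* This square equals [b * (b * ip x x - a * conjc a)]; dividing by [b > 0] leaves the claim. *)
have : 0 <= ip (b *: x - a *: y) (b *: x - a *: y).
  by rewrite ip_norm exprn_ge0.
rewrite ipBl !ipBr !ipZl !ipZr (ipC y x) -/a bE bJ.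
have -> : b * (b * ip x x) - b * (conjc a * a) - (a * (b * conjc a) - a * (conjc a * b)) =
          b * (b * ip x x - a * conjc a) by ring.
rewrite pmulr_rge0 // -sqr_normc subr_ge0 -bE !ip_norm -exprMn => h.
by rewrite -(@ler_pXn2r _ 2) // ?nnegrE ?mulr_ge0 // mulrC.
Qed.

End InnerProduct.

(** * Real-valued norms and geometric convergence *)

Section RealNorm.
Variables (R : realType).

(** Moduli and norms over [R[i]] take values in [R[i]]; their real parts bring estimates into the
    ordered field [R], where [lra] applies. *)
Definition cabs (a : R[i]) : R := complex.Re `|a|.

Lemma cabsE a : `|a| = (cabs a)%:C.
Proof. by rewrite RRe_real // normr_real. Qed.

Lemma cabsD a b : cabs (a + b) <= cabs a + cabs b.
Proof. by rewrite -lecR rmorphD /= -!cabsE ler_normD. Qed.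

Lemma cabs_real (a : R) : cabs a%:C = `|a|.
Proof. by rewrite /cabs normc_def /= expr0n addr0 sqrtr_sqr. Qed.

Lemma cabs_Re (a : R[i]) : `|complex.Re a| <= cabs a.
Proof. by rewrite -lecR -cabsE normc_ge_Re. Qed.

Definition rnorm (V : normedModType R[i]) (x : V) : R := complex.Re `|x|.

Lemma rnormE (V : normedModType R[i]) (x : V) : `|x| = (rnorm x)%:C.
Proof. by rewrite RRe_real // normr_real. Qed.

Lemma rnorm_ge0 (V : normedModType R[i]) (x : V) : 0 <= rnorm x.
Proof. by rewrite -ler0c -rnormE. Qed.

Lemma rnormD (V : normedModType R[i]) (x y : V) :
  rnorm (x + y) <= rnorm x + rnorm y.
Proof. by rewrite -lecR rmorphD /= -!rnormE ler_normD. Qed.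

Lemma rnormB (V : normedModType R[i]) (x y : V) : rnorm (x - y) = rnorm (y - x).
Proof. by rewrite /rnorm distrC. Qed.

Lemma rnormBD (V : normedModType R[i]) (x y z : V) :
  rnorm (x - z) <= rnorm (x - y) + rnorm (y - z).
Proof. by rewrite (le_trans _ (rnormD _ _)) // addrA subrK. Qed.

Lemma rnormZ (V : normedModType R[i]) (a : R[i]) (x : V) :
  rnorm (a *: x) = cabs a * rnorm x.
Proof. by apply: complexI; rewrite rmorphM /= -!rnormE -cabsE normrZ. Qed.

Lemma rnorm_gt0 (V : normedModType R[i]) (x : V) : x != 0 -> 0 < rnorm x.
Proof. by move=> x0; rewrite -ltcR -rnormE normr_gt0. Qed.

Lemma cabs_ip (H : hilbertType R) (x y : H) :
  cabs (ip x y) <= rnorm x * rnorm y.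
Proof. by rewrite -lecR rmorphM /= -!rnormE -cabsE cauchy_schwarz. Qed.

Lemma ip_rnorm (H : hilbertType R) (x : H) : ip x x = (rnorm x ^+ 2)%:C.
Proof. by rewrite ip_norm rnormE rmorphXn. Qed.

Lemma geometric_eq0 (a C : R) : (forall n, `|a| <= C * 2^-1 ^+ n) -> a = 0.
Proof.
move=> h; apply/eqP; rewrite -normr_le0 leNgt; apply/negP => a0.
have C0 : 0 < C by have := h 0%N; rewrite expr0 mulr1; apply: lt_le_trans.
have [n] : exists n : nat, C / `|a| < n%:R.
  by exists (Num.truncn (C / `|a|)).+1; exact: truncnS_gt.
rewrite ltr_pdivrMr // => nC.
have := h n; rewrite exprVn ler_pdivlMr ?exprn_gt0 // => h1.
have : n%:R <= 2 ^+ n :> R by rewrite -natrX ler_nat ltnW // ltn_expl.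
by move=> /(ler_wpM2r (ltW a0)) h2; lra.
Qed.

(** The geometric bound makes [u] Cauchy; letting [m] tend to infinity keeps the rate [e]. *)
Lemma cauchy_rate_limit (V : completeNormedModType R[i]) (u : nat -> V)
    (e : nat -> R) (C : R) :
  (forall n m, (n <= m)%N -> rnorm (u n - u m) <= e n) ->
  (forall n, e n <= C * 2^-1 ^+ n) ->
  exists l, forall n, rnorm (u n - l) <= e n.
Proof.
move=> cauchy_u eC.
have e_small (eps : R[i]) : 0 < eps -> exists n, (e n)%:C < eps.
  move=> eps0; apply: contrapT => /forallNP noe.
  have epsE : eps = (complex.Re eps)%:C by rewrite RRe_real // gtr0_real.
  move: eps0; rewrite epsE => eps0; move: (eps0).
  (* If no [e n] were below [eps], then [eps] would be at most [C / 2 ^ n] for all [n], hence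
     zero. *)
  rewrite (@geometric_eq0 (complex.Re eps) C) ?ltxx // => n.
  rewrite ger0_norm; last by rewrite -lecR ltW.
  rewrite (le_trans _ (eC n)) // leNgt -ltcR -epsE.
  exact/negP/noe.
have cu : cvg (u @ \oo).
  apply/cauchy_cvgP/cauchy_exP => eps /e_small[n en].
  exists (u n), n => // m /= nm.
  by rewrite -ball_normE /ball_ /= rnormE (le_lt_trans _ en) // lecR cauchy_u.
move/cvg_ex: cu => [/= l ul]; exists l => n.
apply/ler_addgt0Pl => eps eps0; rewrite [eps + _]addrC.
have epsC : 0 < eps%:C by rewrite ltcR.
have /cvgrPdist_lt/(_ _ epsC)[N _ hN] := ul.
have := hN (maxn N n) (leq_maxl _ _); rewrite /= rnormE ltcR rnormB => /ltW lN.
apply: le_trans (rnormBD _ (u (maxn N n)) _) _.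
by rewrite lerD // cauchy_u // leq_maxr.
Qed.

End RealNorm.

(** * Uniform boundedness by a gliding hump *)

Section UniformBoundedness.
Variables (R : realType) (H : hilbertType R).

(* Gliding hump: of the two points x + w and x - w with w along z, one satisfies
   |<., z>| >= |<w, z>|. *)
Lemma hump (x z : H) (r : R) : 0 <= r ->
  exists y, rnorm (x - y) <= r /\ r * rnorm z <= cabs (ip y z).
Proof.
move=> r0; have [->|z0] := eqVneq z 0.
  by exists x; rewrite subrr ip0r /rnorm /cabs !normr0 mulr0.
have nz : rnorm z != 0 by rewrite gt_eqF // rnorm_gt0.
pose w := (r / rnorm z)%:C *: z.
have nw : rnorm w = r.
  rewrite rnormZ cabs_real ger0_norm ?divr_ge0 ?rnorm_ge0 //.
  by rewrite divfK.
have ipw : ip w z = (r * rnorm z)%:C.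
  by rewrite ipZl ip_rnorm -rmorphM /=; congr (_ %:C); field.
(* The difference of the two products is [2 * ip w z], so they cannot both be small. *)
have : 2 * (r * rnorm z) <= cabs (ip (x + w) z) + cabs (ip (x - w) z).
  have -> : 2 * (r * rnorm z) = cabs (ip (x + w) z - ip (x - w) z).
    rewrite ipDl ipBl ipw opprB addrC subrKA -rmorphD cabs_real ger0_norm.
      by rewrite mulr_natl mulr2n.
    by rewrite addr_ge0 // mulr_ge0 // rnorm_ge0.
  apply: le_trans (cabsD _ _) _.
  by rewrite lerD2l /cabs normrN.
have [h _|h h'] := leP (r * rnorm z) (cabs (ip (x + w) z)).
  by exists (x + w); split => //; rewrite rnormB addrC addKr nw.
exists (x - w); split; first by rewrite opprB addrC subrK nw.
by lra.
Qed.

(** The weights [p i] may vanish, so nothing is normalized. If no [C] works, humps of size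
    [q ^+ n * rnorm (z (i_ n))] are placed at successive points [x n.+1]; two thirds of each survive
    at the limit [l], against the pointwise bound there. *)
Lemma hilbert_uniform_boundedness (I : Type) (z : I -> H) (p : I -> R) :
  (forall i, 0 <= p i) ->
  (forall u, exists M : R, forall i, cabs (ip u (z i)) <= M * p i) ->
  exists C : R, forall i, rnorm (z i) <= C * p i.
Proof.
move=> p0 pointwise; apply: contrapT => noC.
(* With this ratio all moves after step [n] add up to at most [4 / 3 * q ^+ n.+1], a third of
   [q ^+ n]. *)
pose q : R := 4^-1.
have q0 n : 0 < q ^+ n by rewrite exprn_gt0 // invr_gt0.
have /choice[i_ zi] : forall n : nat, exists i : I,
    3 * n%:R * p i < q ^+ n * rnorm (z i).
  move=> n.
  apply: contrapT => /forallNP noi; apply: noC; exists (3 * n%:R / q ^+ n) => i.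
  have /negP := noi i; rewrite -leNgt => hi.
  by rewrite mulrAC ler_pdivlMr // mulrC.
have /choice[step stepP] (nx : nat * H) : exists y, rnorm (nx.2 - y) <= q ^+ nx.1 /\
    q ^+ nx.1 * rnorm (z (i_ nx.1)) <= cabs (ip y (z (i_ nx.1))).
  exact: hump (ltW (q0 _)).
pose x := fix x n := if n is m.+1 then step (m, x m) else 0.
have x_step n : rnorm (x n - x n.+1) <= q ^+ n by have [] := stepP (n, x n).
have x_hump n : q ^+ n * rnorm (z (i_ n)) <= cabs (ip (x n.+1) (z (i_ n))).
  by have [] := stepP (n, x n).
have x_cauchy n m : (n <= m)%N -> rnorm (x n - x m) <= 4 / 3 * q ^+ n.
  move=> /subnK <-; set k := (m - n)%N.
  (* The exact partial sum of the geometric series is a bound that passes through the induction. *)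
  apply: (@le_trans _ _ (4 / 3 * (q ^+ n - q ^+ (k + n)))); last first.
    by rewrite ler_pM2l ?gerBl ?ltW // divr_gt0.
  elim: k => [|k IHk]; first by rewrite add0n !subrr mulr0 /rnorm normr0.
  apply: le_trans (rnormBD _ (x (k + n)%N) _) _.
  rewrite addSn exprS (_ : 4 / 3 * _ = 4 / 3 * (q ^+ n - q ^+ (k + n)) + q ^+ (k + n)).
    by rewrite lerD.
  by rewrite {2}/q; field.
have [l xl] : exists l, forall n, rnorm (x n - l) <= 4 / 3 * q ^+ n.
  apply: (cauchy_rate_limit (C := 4 / 3)) => // n.
  rewrite ler_pM2l ?divr_gt0 //.
  by apply: lerXn2r; rewrite ?nnegrE ?invr_ge0 // lef_pV2 ?posrE // ler_nat.
have [M lM] := pointwise l.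
have lz n : 2 / 3 * (q ^+ n * rnorm (z (i_ n))) <= cabs (ip l (z (i_ n))).
  have := cabsD (ip (x n.+1 - l) (z (i_ n))) (ip l (z (i_ n))).
  rewrite -ipDl subrK; have := x_hump n.
  have := cabs_ip (x n.+1 - l) (z (i_ n)).
  have := ler_wpM2r (rnorm_ge0 (z (i_ n))) (xl n.+1).
  rewrite exprS {2}/q; set a := q ^+ n; set b := rnorm (z _).
  have -> : 4 / 3 * (4^-1 * a) * b = 1 / 3 * (a * b) by field.
  set ab := a * b; lra.
have [n Mn] : exists n : nat, M < n%:R.
  by exists (Num.truncn M).+1; exact: truncnS_gt.
(* At this index [2 * n * p] is strictly below [M * p], which is at most [n * p]: impossible for
   [n * p >= 0]. *)
have np0 : 0 <= n%:R * p (i_ n) by rewrite mulr_ge0.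
have := zi n; have := lM (i_ n); have := lz n.
have := ler_wpM2r (p0 (i_ n)) (ltW Mn); rewrite -[3 * _ * _]mulrA.
set a := q ^+ n * _; set b := n%:R * _ in np0 *.
by move=> *; lra.
Qed.

End UniformBoundedness.

(** * Riesz representation *)

Section Riesz.
Variables (R : realType) (H : hilbertType R).

Lemma complex_ReD (a b : R[i]) : complex.Re (a + b) = complex.Re a + complex.Re b.
Proof. by case: a; case: b. Qed.

Lemma complex_ReB (a b : R[i]) : complex.Re (a - b) = complex.Re a - complex.Re b.
Proof. by case: a; case: b. Qed.

Lemma complex_ReZ (t : R) (a : R[i]) : complex.Re (t%:C * a) = t * complex.Re a.
Proof. by case: a => x y /=; rewrite mul0r subr0. Qed.

(* The representing vector minimizes |x|^2 - 2 Re (f x): this functional is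
   uniformly convex, so minimizing sequences are Cauchy. *)
Lemma riesz_representation (f : H -> R[i]) (M : R) :
  (forall a u v, f (a *: u + v) = a * f u + f v) ->
  (forall u, cabs (f u) <= M * rnorm u) ->
  exists l, forall u, f u = ip u l.
Proof.
move=> f_lin f_bd.
pose phi x := rnorm x ^+ 2 - 2 * complex.Re (f x).
(* Half the derivative of [phi] at [x] along [h]; its vanishing at the minimizer is the real part of
   the claim. *)
pose G h x := complex.Re (ip h x) - complex.Re (f h).
have phiE x h (t : R) :
    phi (x + t%:C *: h) = phi x + t ^+ 2 * rnorm h ^+ 2 + 2 * (t * G h x).
  have sqE (v : H) : rnorm v ^+ 2 = complex.Re (ip v v) by rewrite ip_rnorm.
  rewrite /phi [x + _]addrC f_lin !sqE ipDl !ipDr !ipZl !ipZr !complex_ReD.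
  rewrite !complex_ReZ conjc_real !complex_ReZ (ipC x h) /G.
  by case: (ip h x) => a b /=; ring.
have phi_ge x : - M ^+ 2 <= phi x.
  have := le_trans (cabs_Re (f x)) (f_bd x); rewrite ler_norml => /andP[_].
  by have := sqr_ge0 (rnorm x - M); rewrite /phi sqrrB; lra.
pose d := inf (range phi).
have phi_inf : has_inf (range phi).
  split; first by exists (phi 0), 0.
  by exists (- M ^+ 2) => _ [x _ <-].
have d_le x : d <= phi x by apply: ge_inf; [case: phi_inf | exists x].
pose q : R := 2^-1.
have q0 n : 0 < q ^+ n by rewrite exprn_gt0 // invr_gt0.
have /choice[x xP] (n : nat) : exists x, phi x < d + (q ^+ n) ^+ 2.
  have [_ [y _ <-] yd] := inf_adherent (exprn_gt0 2 (q0 n)) phi_inf.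
  by exists y.
have x_cauchy n m : (n <= m)%N -> rnorm (x n - x m) <= 2 * q ^+ n.
  move=> nm; rewrite rnormB; set h := x m - x n.
  have qmn : (q ^+ m) ^+ 2 <= (q ^+ n) ^+ 2.
    apply: lerXn2r; rewrite ?nnegrE ?(ltW (q0 _)) //.
    by rewrite ler_wiXn2l ?invr_ge0 // invf_le1 // ler1n.
  rewrite -(@ler_pXn2r _ 2) ?nnegrE ?rnorm_ge0 ?mulr_ge0 ?(ltW (q0 n)) // exprMn.
  (* Parallelogram argument: the value at the midpoint is the mean of the end values minus
     [rnorm h ^+ 2 / 4], and is at least [d]. *)
  have := phiE (x n) h 1; have := phiE (x n) h 2^-1.
  rewrite scale1r [x n + h]addrC subrK.
  have := d_le (x n + 2^-1%:C *: h); have := xP n; have := xP m.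
  rewrite expr1n; move: (G h (x n)) (phi (x n + _)) => g p.
  set a := rnorm h ^+ 2; set b := q ^+ n ^+ 2 in qmn *.
  by set c := q ^+ m ^+ 2 in qmn *; lra.
have [l xl] : exists l, forall n, rnorm (x n - l) <= 2 * q ^+ n.
  exact: (cauchy_rate_limit (C := 2)).
have fl h : complex.Re (ip h l) = complex.Re (f h).
  apply/eqP; rewrite -subr_eq0; apply/eqP.
  apply: (@geometric_eq0 R _ ((1 + rnorm h ^+ 2) / 2 + rnorm h * 2)) => n.
  have xlh : `|complex.Re (ip h l) - complex.Re (ip h (x n))| <= rnorm h * 2 * q ^+ n.
    rewrite -complex_ReB -ipBr (le_trans (cabs_Re _)) //.
    rewrite (le_trans (cabs_ip _ _)) // -mulrA ler_wpM2l ?rnorm_ge0 //.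
    by rewrite rnormB.
  have Gle : `|G h (x n)| <= (1 + rnorm h ^+ 2) / 2 * q ^+ n.
    (* [x n] is within [(q ^+ n) ^+ 2] of the infimum; steps of length [q ^+ n] both ways then bound
       the derivative by a multiple of [q ^+ n]. *)
    have := d_le (x n + (q ^+ n)%:C *: h); have := d_le (x n + (- q ^+ n)%:C *: h).
    rewrite !phiE sqrrN; have := xP n; set a := rnorm h ^+ 2; set g := G h (x n).
    move=> h1 h2 h3; rewrite -(ler_pM2l (q0 n)) mulrCA -expr2.
    rewrite -[X in X * _](gtr0_norm (q0 n)) -normrM ler_norml.
    set b := q ^+ n ^+ 2 in h1 h2 h3 *; set c := q ^+ n * g in h2 h3 *.
    rewrite -/c; apply/andP; move: h2 h3; rewrite !mulNr -/c => h2 h3.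
    by split; lra.
  have -> : complex.Re (ip h l) - complex.Re (f h) =
      G h (x n) + (complex.Re (ip h l) - complex.Re (ip h (x n))) by rewrite /G; ring.
  by rewrite mulrDl (le_trans (ler_normD _ _)) // lerD.
exists l => u.
(* The real part at ['i *: u] is minus the imaginary part at [u]. *)
have := fl u; have := fl ('i *: u).
have -> : f ('i *: u) = 'i * f u.
  by have := f_lin 'i u 0; have := f_lin (-1) 0 0;
    rewrite scaler0 !addr0 mulN1r addNr => -> ->; rewrite addr0.
rewrite ipZl; case: (f u) => a b; case: (ip u l) => c e /=.
by rewrite !mul0r !mul1r !sub0r => /oppr_inj -> ->.
Qed.

End Riesz.

(** * The Hilbert sum and Lagrangian projections *)

Section HilbertSum.
Variables (R : realType) (F : hilbertType R).
Implicit Types f g h : F * F.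

Lemma ip2Dr f g h : ip2 f (g + h) = ip2 f g + ip2 f h.
Proof. by rewrite /ip2 /= !ipDr addrACA. Qed.

Lemma ip2_linearl (a : R[i]) f g h : ip2 (a *: f + g) h = a * ip2 f h + ip2 g h.
Proof. by rewrite /ip2 /= !ipDl !ipZl mulrDr addrACA. Qed.

Lemma ip2_eq0 f : ip2 f f = 0 -> f = 0.
Proof.
rewrite /ip2 !ip_norm => /eqP; rewrite paddr_eq0 ?exprn_ge0 // !expf_eq0 /=.
by rewrite !normr_eq0; case: f => x y /= /andP[/eqP -> /eqP ->].
Qed.

Lemma rnorm_pair f : rnorm f = Num.max (rnorm f.1) (rnorm f.2).
Proof.
rewrite {1}/rnorm prod_normE !rnormE /Order.max ltcR.
by case: ifP => _; rewrite -rnormE.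
Qed.

(** The factor 2 is the price of the max norm on [F * F]. *)
Lemma cabs_ip2 f g : cabs (ip2 f g) <= 2 * (rnorm f * rnorm g).
Proof.
rewrite mulr_natl mulr2n (le_trans (cabsD _ _)) //.
by apply: lerD; apply: le_trans (cabs_ip _ _) _;
  apply: ler_pM; rewrite ?rnorm_ge0 // rnorm_pair le_max lexx ?orbT.
Qed.

Lemma rnorm_sqr_le_ip2 f : rnorm f ^+ 2 <= cabs (ip2 f f).
Proof.
rewrite /ip2 !ip_rnorm -rmorphD cabs_real ger0_norm ?addr_ge0 ?sqr_ge0 //.
by rewrite rnorm_pair /Order.max; case: ifP; rewrite ?lerDl ?lerDr sqr_ge0.
Qed.

Lemma rnorm_J f : rnorm (J f) = rnorm f.
Proof. by rewrite !rnorm_pair /= maxC /rnorm normrN. Qed.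

Lemma JB f g : J (f - g) = J f - J g.
Proof. by rewrite /J /= opprD. Qed.

Lemma JK f : J (- J f) = f.
Proof. by case: f => x y; rewrite /J /= !opprK. Qed.

(** [J] sends a Lagrangian subspace into its orthogonal complement: [ip2 (Q (J f)) (Q (J f))] is
    [omega f g] for some [g] in the range of [Q]. *)
Lemma lagrangian_projection (Q : F * F -> F * F) f :
  orthogonal_projection Q -> lagrangian (range Q) -> range Q f -> Q (J f) = 0.
Proof.
move=> [_ _ Q_symm] Q_lagr; rewrite {1}Q_lagr => Qf; apply: ip2_eq0.
by rewrite Q_symm; apply: Qf; do 2 eexists.
Qed.

End HilbertSum.

(** * Bounded operators and their adjoints *)

Section BoundedOperators.
Variables (R : realType).

Lemma bounded_operatorP (X Y : normedModType R[i]) (f : X -> Y) :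
  bounded_operator f <->
  linear f /\ exists C : R, forall x, rnorm (f x) <= C * rnorm x.
Proof.
split=> -[f_lin [M fM]]; split=> //; last first.
  by exists M%:C => x; rewrite !rnormE -rmorphM lecR.
(* A nonzero [x] forces [M] to be real and nonnegative, but on a trivial space [M] is arbitrary; its
   modulus covers both cases. *)
exists (cabs M) => x.
rewrite -lecR rmorphM /= -!rnormE -cabsE; apply: le_trans (fM x) _.
have /ger0_norm <- : 0 <= M * `|x| by apply: le_trans (fM x).
by rewrite normrM normr_id.
Qed.

Variables (H F : hilbertType R).
Implicit Types (f : H -> F * F) (y : F * F).

Let star := adjoint (@ip R H) (@ip2 R F).

(** Nondegeneracy makes the vector chosen by [get] unique, so exhibiting a candidate computes the
    adjoint. *)
Lemma adjointE f y z : (forall u, ip2 (f u) y = ip u z) -> star f y = z.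
Proof.
move=> fyz; apply: ip_inj => u; rewrite -fyz.
have : [set x | forall u, ip2 (f u) y = ip u x] !=set0 by exists z.
by move=> /(getPex)/(_ u) <-.
Qed.

Lemma adjointP f y : bounded_operator f ->
  forall u, ip2 (f u) y = ip u (star f y).
Proof.
move=> /bounded_operatorP[f_lin [C fC]].
have [] := @riesz_representation _ _ (fun u => ip2 (f u) y) (2 * C * rnorm y).
- by move=> a u v; rewrite f_lin ip2_linearl.
- move=> u; apply: le_trans (cabs_ip2 _ _) _.
  by rewrite -!mulrA ler_pM2l // [rnorm y * _]mulrC mulrA ler_wpM2r ?rnorm_ge0.
- by move=> l fl u; rewrite (adjointE fl) -fl.
Qed.

Lemma adjointD f y1 y2 : bounded_operator f ->
  star f (y1 + y2) = star f y1 + star f y2.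
Proof.
by move=> fb; apply: adjointE => u; rewrite ip2Dr ipDr !(adjointP _ fb).
Qed.

End BoundedOperators.

Lemma dense_rnorm (R : realType) (X : normedModType R[i]) (S : set X) :
  dense S -> forall x (e : R), 0 < e -> exists2 y, S y & rnorm (x - y) < e.
Proof.
move=> S_dense x e e0.
have eC : 0 < e%:C by rewrite ltcR.
have [|y [] xy Sy] := S_dense _ _ (@open_interior _ (ball x e%:C)).
  exists x; rewrite /interior; exact: nbhsx_ballx.
exists y => //; move/interior_subset: xy.
by rewrite -ball_normE /ball_ /= rnormE ltcR.
Qed.

(** * Self-adjoint operators and resolvents *)

Section UnboundedOperatorTheory.
Variables (R : realType) (H : hilbertType R).
Implicit Types (A B : partial_map H) (u v w x y : H) (z : R[i]).

(** A nonzero [v - w] orthogonal to [S] could not be approximated from [S] to within less than its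
    own norm. *)
Lemma dense_ip_eq (S : set H) v w :
  dense S -> (forall u, S u -> ip u v = ip u w) -> v = w.
Proof.
move=> S_dense vw; apply/eqP; rewrite -subr_eq0; apply/negPn/negP => d0.
have [u Su] := dense_rnorm S_dense (v - w) (rnorm_gt0 d0).
apply/negP; rewrite -leNgt -(ler_pM2r (rnorm_gt0 d0)).
rewrite -expr2 -[X in X <= _]ger0_norm ?sqr_ge0 // -cabs_real -ip_rnorm.
have -> : ip (v - w) (v - w) = ip (v - w - u) (v - w).
  by rewrite [RHS]ipBl [ip u _]ipBr (vw _ Su) subrr subr0.
exact: cabs_ip.
Qed.

Lemma adjE A v w : densely_defined A ->
  (forall u, dom A u -> ip (A u) v = ip u w) ->
  dom (adj A) v /\ adj A v = w.
Proof.
move=> A_dense vw; have ex : [set w | forall u, dom A u -> ip (A u) v = ip u w] !=set0.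
  by exists w.
split=> //; apply: (dense_ip_eq A_dense) => u Au.
by have /(_ u Au) <- := getPex ex; exact: vw.
Qed.

Lemma adjP A u v : dom A u -> dom (adj A) v -> ip (A u) v = ip u (adj A v).
Proof. by move=> Au /getPex/(_ u Au). Qed.

Lemma self_adjoint_symmetric A : self_adjoint A -> symmetric_operator A.
Proof.
move=> [_ _ domE adjA] u v Au Av.
by rewrite (adjP Au) ?domE // adjA.
Qed.

Lemma self_adjoint_maximal A v w : self_adjoint A ->
  (forall u, dom A u -> ip (A u) v = ip u w) -> dom A v /\ A v = w.
Proof.
move=> [_ A_dense domE adjA] /(adjE A_dense)[].
by rewrite domE => Av; rewrite adjA.
Qed.

(** The inclusion of [B = B^*] in [A^*]; it replaces [A^*] by [cA t] in the Green identity. *)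
Lemma adj_extension A B u : densely_defined A -> extension A B ->
  self_adjoint B -> dom B u -> adj A u = B u.
Proof.
move=> A_dense [domAB AB] B_sa Bu; apply: (proj2 (adjE A_dense _)) => v Av.
by rewrite -AB //; apply: self_adjoint_symmetric => //; exact: domAB.
Qed.

Lemma perturb_self_adjoint A (V : H -> H) : self_adjoint A ->
  linear V -> (forall x y, ip (V x) y = ip x (V y)) ->
  self_adjoint (perturb A V).
Proof.
move=> A_sa V_lin V_sa; have [[A0 A_lin] A_dense domE adjA] := A_sa.
have pert_adj v : dom A v -> dom (adj (perturb A V)) v /\
    adj (perturb A V) v = A v + V v.
  move=> Av; apply: adjE => // u Au /=.
  by rewrite ipDl ipDr V_sa (self_adjoint_symmetric A_sa).
split=> //; last by move=> u /pert_adj[].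
- split=> // a u v Au Av; have [? Auv] := A_lin a u v Au Av; split=> //=.
  by rewrite Auv V_lin scalerDr addrACA.
- apply/seteqP; split=> v /= hv; last by have [] := pert_adj v hv.
  (* Moving the symmetric [V] to the other side turns the adjoint relation for [A + V] into one for
     [A]. *)
  have [] // := @self_adjoint_maximal A v (adj (perturb A V) v - V v) A_sa.
  move=> u Au; have := @adjP (perturb A V) u v Au hv; rewrite /= ipDl ipBr -V_sa => <-.
  by rewrite addrK.
Qed.

(** Assumes unique solvability only, because [resolvent_set_conj] applies it before boundedness is
    known. *)
Lemma resolvent_spec A z x :
  (exists! u, dom A u /\ A u - z *: u = x) ->
  dom A (resolvent A z x) /\
  A (resolvent A z x) - z *: resolvent A z x = x.
Proof.
by case=> u [Au _]; apply: (@getPex _ [set u | dom A u /\ _]); exists u.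
Qed.

Lemma resolventP A z x : resolvent_set A z ->
  dom A (resolvent A z x) /\
  A (resolvent A z x) - z *: resolvent A z x = x.
Proof. by move=> [bij _]; exact: resolvent_spec. Qed.

Lemma resolventE A z x u : resolvent_set A z ->
  dom A u -> A u - z *: u = x -> resolvent A z x = u.
Proof.
move=> zA Au Aux; have [/(_ x)[v [_ uniq_v]] _] := zA.
by rewrite -(uniq_v _ (resolventP x zA)) -(uniq_v u).
Qed.

Lemma resolvent_linear A z : linear_operator A ->
  (forall x, exists! u, dom A u /\ A u - z *: u = x) -> linear (resolvent A z).
Proof.
move=> [_ A_lin] bij a x y.
have [v [_ uniq_v]] := bij (a *: x + y).
rewrite -(uniq_v _ (resolvent_spec (bij _))); apply: uniq_v.
have [Ax Ex] := resolvent_spec (bij x); have [Ay Ey] := resolvent_spec (bij y).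
have [dxy Exy] := A_lin a _ _ Ax Ay; split=> //.
rewrite Exy -{3}Ex -{3}Ey scalerBr scalerDr opprD addrACA.
by rewrite !scalerA [z * a]mulrC.
Qed.

Lemma resolvent_adjoint A z x y : self_adjoint A ->
  resolvent_set A z -> resolvent_set A (conjc z) ->
  ip (resolvent A (conjc z) x) y = ip x (resolvent A z y).
Proof.
move=> A_sa zA zA'.
have [Au Eu] := resolventP x zA'; have [Av Ev] := resolventP y zA.
rewrite -{1}Ev -{2}Eu ipBl ipBr ipZl ipZr.
by rewrite (self_adjoint_symmetric A_sa).
Qed.

(* Surjectivity of A - conj z comes from Riesz: the vector representing
   y |-> <(A - z)^-1 y, x> lies in the domain of the adjoint of A. *)
Lemma resolvent_set_conj A z : self_adjoint A ->
  resolvent_set A z -> resolvent_set A (conjc z).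
Proof.
move=> A_sa zA; have [[_ A_lin] _ _ _] := A_sa.
have [_ /bounded_operatorP[R_lin [C R_bd]]] := zA.
(* This determines [w] from [v], giving uniqueness, and later transfers the bound [C]. *)
have ker w v : dom A w -> A w - conjc z *: w = v ->
    forall y, ip w y = ip v (resolvent A z y).
  move=> Aw <- y; have [Ay Ey] := resolventP y zA.
  by rewrite -{1}Ey ipBl ipBr ipZl ipZr (self_adjoint_symmetric A_sa).
have bij x : exists! u, dom A u /\ A u - conjc z *: u = x.
  have [||l xl] := @riesz_representation _ _ (fun y => ip (resolvent A z y) x)
    (C * rnorm x).
  - by move=> a u v; rewrite R_lin ipDl ipZl.
  - move=> u; rewrite (le_trans (cabs_ip _ _)) // mulrAC.
    by rewrite ler_wpM2r ?rnorm_ge0.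
  have [Al El] : dom A l /\ A l = x + conjc z *: l.
    apply: self_adjoint_maximal => // u Au.
    have := xl (A u - z *: u); rewrite (resolventE zA Au erefl).
    by rewrite ipBl ipDr ipZl ipZr conjcK => ->; rewrite subrK.
  have {}El : A l - conjc z *: l = x by rewrite El addrK.
  exists l; split=> // v [Av Ev]; apply: ip_inj => u.
  by rewrite ipC [RHS]ipC (ker _ _ Av Ev) (ker _ _ Al El).
split=> //; apply/bounded_operatorP; split.
  by apply: resolvent_linear => //; case: A_sa.
exists C => x; set u := resolvent A (conjc z) x.
have [Au Eu] := resolvent_spec (bij x); rewrite -/u in Au Eu.
(* For [u = 0] the bound at [z] shows [C * rnorm x >= 0]; otherwise
   [ip u u = ip x (resolvent A z u)] is divided by [rnorm u]. *)
have [->|u0] := eqVneq u 0.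
  have := R_bd x; have := rnorm_ge0 (resolvent A z x).
  rewrite /rnorm normr0 /=; exact: le_trans.
rewrite -(ler_pM2r (rnorm_gt0 u0)) -expr2 -[X in X <= _]ger0_norm ?sqr_ge0 //.
rewrite -cabs_real -ip_rnorm (ker _ _ Au Eu) (le_trans (cabs_ip _ _)) //.
by rewrite mulrAC [C * _ * _]mulrC ler_wpM2l ?rnorm_ge0.
Qed.

End UnboundedOperatorTheory.
(* The vectors z i are the values of the densely defined adjoint of B at J (T i),
   so uniform boundedness replaces the closed graph theorem. *)
Lemma bounded_operator_dense_adjoint (R : realType) (H F : hilbertType R)
    (I : Type) (B : H -> F * F) (T : I -> F * F) (z : I -> H) :
  linear B -> dense (range T) ->
  (forall u i, ip2 (B u) (J (T i)) = ip u (z i)) ->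
  bounded_operator B.
Proof.
move=> B_lin T_dense BT; apply/bounded_operatorP; split=> //.
have [||C zC] := @hilbert_uniform_boundedness _ _ _ z (fun i => rnorm (T i)).
- by move=> i; rewrite rnorm_ge0.
- move=> u; exists (2 * rnorm (B u)) => i; rewrite -BT -mulrA.
  by rewrite (le_trans (cabs_ip2 _ _)) // rnorm_J.
(* With [f = B u] and [T i] within [rnorm f / 4] of [- J f], half of [rnorm f ^+ 2] is absorbed and
   the rest is at most [2 * |C| * rnorm u * rnorm f]. *)
exists (4 * `|C|) => u; have [->|f0] := eqVneq (B u) 0.
  by rewrite {1}/rnorm normr0 !mulr_ge0 ?rnorm_ge0.
set f := B u in f0 *.
have nf := rnorm_gt0 f0.
have [y [i _ <-] yf] : exists2 y, range T y & rnorm (- J f - y) < rnorm f / 4.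
  by apply: dense_rnorm; rewrite ?divr_gt0.
have le_T : rnorm (T i) <= 2 * rnorm f.
  have := rnormBD (T i) (- J f) 0; rewrite !subr0 rnormB.
  by rewrite [rnorm (- J f)]/rnorm normrN -/(rnorm (J f)) rnorm_J; lra.
have le_z : rnorm u * rnorm (z i) <= rnorm u * (`|C| * (2 * rnorm f)).
  rewrite ler_wpM2l ?rnorm_ge0 // (le_trans (zC i)) //.
  by rewrite (le_trans (ler_norm _)) // normrM ler_wpM2l // ger0_norm ?rnorm_ge0.
have le_f : rnorm f * rnorm (- J f - T i) <= rnorm f * (rnorm f / 4).
  by rewrite ler_wpM2l ?rnorm_ge0 // ltW.
have ipf : ip2 f f = ip2 f (J (- J f - T i)) + ip u (z i).
  by rewrite -BT -ip2Dr JB JK subrK.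
have := rnorm_sqr_le_ip2 f; rewrite ipf => /le_trans/(_ (cabsD _ _)).
have := cabs_ip2 f (J (- J f - T i)); rewrite rnorm_J.
have := cabs_ip u (z i).
move=> h1 h2 h3; rewrite -(ler_pM2l nf).
have -> : rnorm f * (4 * `|C| * rnorm u) = 2 * (rnorm u * (`|C| * (2 * rnorm f))) by ring.
rewrite mulrA -expr2 in le_f.
rewrite -expr2; set a := rnorm f ^+ 2 in le_f h3 *.
by set b := rnorm u * (`|C| * _) in le_z *; lra.
Qed.

(** * The resolvent difference formulas *)

Theorem theorem3p11 (R : realType) (H F : hilbertType R)
  (sepH : separable H) (sepF : separable F)
  (A : partial_map H)
  (A_lin : linear_operator A) (A_dense : densely_defined A)
  (A_closed : closed_operator A) (A_symm : symmetric_operator A)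
  (A_defic : equal_deficiency_indices A)
  (* the Banach space D, identified with the subspace [range iota] of dom A^* *)
  (D : completeNormedModType R[i]) (iota : {linear D -> H})
  (iota_inj : injective iota)
  (D_sub : range iota `<=` dom (adj A))
  (D_dense : forall u, dom (adj A) u -> forall e : R[i], 0 < e ->
     exists d : D, graph_norm (adj A) (u - iota d) < e)
  (domA_D : dom A `<=` range iota)
  (iota_bounded : exists M : R[i], forall d : D,
     graph_norm (adj A) (iota d) <= M * `|d|)
  (Gamma0 Gamma1 : {i01 R} -> D -> F)
  (T : {i01 R} -> D -> F * F)
  (T_def : forall t d, T t d = (Gamma0 t d, Gamma1 t d))
  (T_bounded : forall t, bounded_operator (T t))
  (T_dense : forall t, dense (range (T t)))
  (green : forall t (u v : D),
     ip (adj A (iota u)) (iota v) - ip (iota u) (adj A (iota v)) =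
     ip (Gamma1 t u) (Gamma0 t v) - ip (Gamma0 t u) (Gamma1 t v))
  (Q : {i01 R} -> F * F -> F * F)
  (Q_proj : forall t, orthogonal_projection (Q t))
  (Q_lagr : forall t, lagrangian (range (Q t)))
  (cA : {i01 R} -> partial_map H)
  (cA_sa : forall t, self_adjoint (cA t))
  (cA_ext : forall t, extension A (cA t))
  (cA_D : forall t, dom (cA t) `<=` range iota)
  (cA_T : forall t,
     closure (T t @` (iota @^-1` dom (cA t))) = range (Q t))
  (V : {i01 R} -> H -> H)
  (V_bounded : forall t, bounded_operator (V t))
  (V_sa : forall t x y, ip (V t x) y = ip x (V t y))
  (t s tau : {i01 R}) (zeta : R[i]) :
  let Hop r := perturb (cA r) (V r) in
  let Rs r z := resolvent (Hop r) z in
  (* T as an operator on the subspace D of H *)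
  let TD r (x : H) : F * F := T r (pinv setT iota x) in
  let star := adjoint (@ip R H) (@ip2 R F) in
  ~ (Spec (Hop t) `|` Spec (Hop s)) zeta ->
  [/\ bounded_operator (TD tau \o Rs t zeta^*),
      bounded_operator (TD t \o Rs t zeta^*),
      forall x : H,
        Rs t zeta x - Rs s zeta x =
        Rs t zeta (V s (Rs s zeta x) - V t (Rs s zeta x))
        + star (TD tau \o Rs t zeta^*) (J (TD tau (Rs s zeta x))) &
      forall x : H,
        Rs t zeta x - Rs s zeta x =
        Rs t zeta (V s (Rs s zeta x) - V t (Rs s zeta x))
        + star (TD t \o Rs t zeta^*)
            (Q t (J (TD s (Rs s zeta x))) - Q s (J (TD s (Rs s zeta x))))
        + star (TD t \o Rs t zeta^*)
            (J (TD t (Rs s zeta x) - TD s (Rs s zeta x)))].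
Proof.
move=> Hop Rs TD star /not_orP[/contrapT t_res /contrapT s_res].
have pinvE d : pinv setT iota (iota d) = d.
  by apply: pinvKV; rewrite ?inE // => d1 d2 _ _; exact: iota_inj.
(* The inverse inside [TD] is meaningful only on the range of [iota], which contains every operator
   domain [dom (cA r)]. *)
have iota_pinv r w : dom (cA r) w -> iota (pinv setT iota w) = w.
  by move=> /cA_D[d _ <-]; rewrite pinvE.
have H_sa r : self_adjoint (Hop r).
  by apply: perturb_self_adjoint => //; case: (V_bounded r).
have t_res' := resolvent_set_conj (H_sa t) t_res.
have Rt_linear z : resolvent_set (Hop t) z -> linear (Rs t z) by move=> [_ []].
have J_green r u v : ip2 (T r u) (J (T r v)) =
    ip (iota u) (adj A (iota v)) - ip (adj A (iota u)) (iota v).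
  by rewrite -[RHS]opprB (green r) !T_def /ip2 /J /= ipNr opprB addrC.
have J_resolvent r u d : ip2 (TD r (Rs t (conjc zeta) u)) (J (T r d)) =
    ip u (Rs t zeta (adj A (iota d) + V t (iota d) - zeta *: iota d) - iota d).
  have [Aw Ew] := resolventP u t_res'; rewrite -/(Rs t _) in Aw Ew.
  rewrite /= in Ew; set w := Rs t _ u in Aw Ew *.
  rewrite J_green (iota_pinv _ _ Aw) (adj_extension A_dense (cA_ext t) _ Aw) //.
  (* With the resolvent moved onto [u] and the other [u] written as [(Hop t - conjc zeta) w], the
     terms in [V t] and [zeta] cancel. *)
  rewrite [RHS]ipBr -(resolvent_adjoint _ _ (H_sa t)) // -/(Rs t _).
  rewrite -/w -[in ip u _]Ew; set a := adj A _.
  rewrite !(ipBl, ipDl, ipBr, ipDr) ipZr ipZl V_sa.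
  by ring.
have TD_bounded r : bounded_operator (TD r \o Rs t (conjc zeta)).
  apply: bounded_operator_dense_adjoint (T_dense r) (J_resolvent r) => a x y /=.
  have [T_lin _] := T_bounded r; rewrite /TD -T_lin; congr (T r _).
  have Aw v : dom (cA t) (Rs t (conjc zeta) v) by have [] := resolventP v t_res'.
  by apply: iota_inj; rewrite linearP !(iota_pinv _ _ (Aw _)) Rt_linear.
have krein r x : Rs t zeta x - Rs s zeta x =
    Rs t zeta (V s (Rs s zeta x) - V t (Rs s zeta x))
    + star (TD r \o Rs t (conjc zeta)) (J (TD r (Rs s zeta x))).
  have [Av Ev] := resolventP x s_res; rewrite -/(Rs s _) /= in Av Ev.
  set v := Rs s zeta x in Av Ev *.
  have adjv : adj A v = x + zeta *: v - V s v.
    by rewrite (adj_extension A_dense (cA_ext s) _ Av) // -[x in RHS]Ev subrK addrK.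
  have -> : star (TD r \o Rs t (conjc zeta)) (J (TD r v)) =
      Rs t zeta (x - V s v + V t v) - v.
    apply: adjointE => u; rewrite /= [TD r v]/TD J_resolvent (iota_pinv s) // adjv.
    congr (ip u (Rs t zeta _ - _)).
    by rewrite addrAC (addrAC (x + _)) addrK.
  (* The two arguments of [Rs t zeta] add up to [x]. *)
  rewrite addrA -[Rs t zeta (V s v - V t v)]scale1r -Rt_linear // scale1r.
  by rewrite [V s v - _ + _]addrC -addrA [V t v + _]addrCA subrr addr0 subrK.
split=> // x.
rewrite (krein t) -addrA -adjointD //; congr (_ + _).
set v := Rs s zeta x; have [Av _] := resolventP x s_res.
have T_range r w : dom (cA r) w -> range (Q r) (TD r w).
  move=> Aw; rewrite -cA_T; apply: subset_closure; exists (pinv setT iota w) => //=.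
  by rewrite (iota_pinv r).
(* Both sides are now values of one adjoint, so they are compared by pairing with
   [TD t (Rs t (conjc zeta) u)]. *)
apply: adjointE => u; rewrite -adjointP //.
rewrite (lagrangian_projection (Q_proj s)) ?subr0 //; last exact: T_range.
have [_ QQ Q_symm] := Q_proj t.
have [f _ Qf] := T_range t _ (proj1 (resolventP u t_res')).
by rewrite ip2Dr /= -[in ip2 _ (Q t _)]Qf -Q_symm QQ Qf -ip2Dr JB addrC subrK.
Qed.
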